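(* The Set-Set logic determined by the matrix $\langle\mathbf{PP}_6^{\Rightarrow_H},{\uparrow}\mathbf b\rangle$ is axiomatized by the $\{p,{\sim}p,\circ p\}$-analytic Set-Set calculus consisting of the rules $\mathsf r_1$–$\mathsf r_{37}$ together with the following rules: $\frac{q}{p\Rightarrow q}$, $\frac{p,\ p\Rightarrow q}{q}$, $\frac{{\sim}(p\Rightarrow q)}{{\sim}q}$, $\frac{{\sim}q}{{\sim}(p\Rightarrow q),{\sim}p}$, $\frac{}{p\Rightarrow q,\circ q,p}$, $\frac{p\Rightarrow q}{\circ(p\Rightarrow q),{\sim}q,q}$, $\frac{p\Rightarrow q,\circ q}{\circ p,q}$, $\frac{{\sim}(p\Rightarrow q),{\sim}p}{\circ(p\Rightarrow q)}$, $\frac{{\sim}p}{\circ(p\Rightarrow q),p}$, $\frac{\circ(p\Rightarrow q),\circ p,p}{\circ q}$, $\frac{\circ(p\Rightarrow q),p}{\circ q,q}$, $\frac{\circ p}{p\Rightarrow q,p}$, $\frac{\circ q}{\circ(p\Rightarrow q)}$, $\frac{q}{{\sim}(p\Rightarrow q),\circ(p\Rightarrow q),\circ p}$.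
   Context: Let $\mathcal{V}_6=\{\hat{\mathbf f},\mathbf f,\mathbf n,\mathbf b,\mathbf t,\hat{\mathbf t}\}$, partially ordered as a bounded distributive lattice by $\hat{\mathbf f}<\mathbf f<\mathbf n<\mathbf t<\hat{\mathbf t}$ and $\mathbf f<\mathbf b<\mathbf t$, with $\mathbf n,\mathbf b$ incomparable. $\mathbf{PP}_6$ is the algebra on $\mathcal V_6$ in the signature $\{\land,\lor,{\sim},\circ,\bot,\top\}$ where $\land,\lor$ are meet and join, $\bot=\hat{\mathbf f}$, $\top=\hat{\mathbf t}$, ${\sim}$ swaps $\mathbf f\leftrightarrow\mathbf t$ and $\hat{\mathbf f}\leftrightarrow\hat{\mathbf t}$ and fixes $\mathbf n,\mathbf b$, and ${\circ}a=\hat{\mathbf t}$ if $a\in\{\hat{\mathbf f},\hat{\mathbf t}\}$, ${\circ}a=\hat{\mathbf f}$ otherwise. $\mathbf{PP}_6^{\Rightarrow_H}$ expands $\mathbf{PP}_6$ by the binary operation $a\Rightarrow b=\max\{c\in\mathcal V_6: a\land c\le b\}$ (relative pseudo-complement). ${\uparrow}\mathbf b=\{\mathbf b,\mathbf t,\hat{\mathbf t}\}$. The Set-Set logic of a matrix $\langle\mathbf A,D\rangle$: $\Phi\rhd\Psi$ iff every homomorphism $h$ from the formula algebra (over a countably infinite set of variables) to $\mathbf A$ has $h(\varphi)\notin D$ for some $\varphi\in\Phi$ or $h(\psi)\in D$ for some $\psi\in\Psi$. Set-Set calculi: a rule $\frac{\Pi}{\Theta}$ is a pair of sets of formulas. A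 derivation in a calculus $\mathsf R$ is a finite rooted tree with nodes labelled by sets of formulas or $\ast$, where each non-leaf node labelled $\Gamma$ is expanded by a rule $\frac{\Pi}{\Theta}\in\mathsf R$ and substitution $\sigma$ with $\sigma(\Pi)\subseteq\Gamma$: its children are labelled $\Gamma\cup\{\theta\}$ for each $\theta\in\sigma(\Theta)$ if $\Theta\neq\varnothing$, else a single child labelled $\ast$. $\Phi\rhd_{\mathsf R}\Psi$ iff some derivation has root label contained in $\Phi$ and all leaves labelled $\ast$ or meeting $\Psi$; $\mathsf R$ axiomatizes $\rhd$ if $\rhd_{\mathsf R}=\rhd$. For a set $\Xi$ of formulas and set $\Gamma$, $\Upsilon^\Xi(\Gamma)$ is the set of subformulas of $\Gamma$ plus all $\sigma(\varphi)$, $\varphi\in\Xi$, $\sigma$ mapping variables to subformulas of $\Gamma$; $\mathsf R$ is $\Xi$-analytic if whenever $\Phi\rhd_{\mathsf R}\Psi$ there is such a derivation using only formulas in $\Upsilon^\Xi(\Phi\cup\Psi)$. The rules $\mathsf r_1$–$\mathsf r_{37}$ are: $\frac{}{\top}$; $\frac{{\sim}\top}{}$; $\frac{}{{\sim}\bot}$; $\frac{\bot}{}$; $\frac{p}{{\sim}{\sim}p}$; $\frac{{\sim}{\sim}p}{p}$; $\frac{p\land q}{p}$; $\frac{p\land q}{q}$; $\frac{p,q}{p\land q}$; $\frac{{\sim}p}{{\sim}(p\land q)}$; $\frac{{\sim}q}{{\sim}(p\land q)}$; $\frac{{\sim}(p\land q)}{{\sim}p,{\sim}q}$; $\frac{p}{p\lor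 q}$; $\frac{q}{p\lor q}$; $\frac{p\lor q}{p,q}$; $\frac{{\sim}p,{\sim}q}{{\sim}(p\lor q)}$; $\frac{{\sim}(p\lor q)}{{\sim}p}$; $\frac{{\sim}(p\lor q)}{{\sim}q}$; $\frac{}{\circ\bot}$; $\frac{}{\circ\top}$; $\frac{}{\circ\circ p}$; $\frac{\circ p}{\circ{\sim}p}$; $\frac{\circ{\sim}p}{\circ p}$; $\frac{\circ p}{p,{\sim}p}$; $\frac{\circ p,p,{\sim}p}{}$; $\frac{\circ p}{\circ(p\land q),p}$; $\frac{\circ q}{\circ(p\land q),q}$; $\frac{\circ(p\land q),q}{\circ p}$; $\frac{\circ(p\land q),p}{\circ q}$; $\frac{\circ p,\circ q}{\circ(p\land q)}$; $\frac{\circ(p\land q)}{\circ p,\circ q}$; $\frac{\circ p,\circ q}{\circ(p\lor q)}$; $\frac{\circ(p\lor q)}{\circ p,\circ q}$; $\frac{\circ p,p}{\circ(p\lor q)}$; $\frac{\circ q,q}{\circ(p\lor q)}$; $\frac{\circ(p\lor q)}{\circ p,q}$; $\frac{\circ(p\lor q)}{\circ q,p}$ (blank side means empty set). *)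

(* Defs.v *)
From Stdlib Require List.
From HB Require Import structures.
From mathcomp Require Import all_boot all_order.
From mathcomp Require Import boolp classical_sets.

Set Implicit Arguments.
Unset Strict Implicit.
Unset Printing Implicit Defensive.

Import Order.TTheory.
Local Open Scope classical_set_scope.

(* Fh and Th stand for f-hat and t-hat. *)
Variant V6 := Fh | F | N | B | T | Th.

Definition V6_code (a : V6) : nat :=
  match a with Fh => 0 | F => 1 | N => 2 | B => 3 | T => 4 | Th => 5 end.

Definition V6_decode (i : nat) : option V6 :=
  match i with
  | 0 => Some Fh | 1 => Some F | 2 => Some N
  | 3 => Some B | 4 => Some T | 5 => Some Th | _ => None
  end.

Fact V6_codeK : pcancel V6_code V6_decode. Proof. by case. Qed.

HB.instance Definition _ := Countable.copy V6 (pcan_type V6_codeK).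

Fact V6_enumP : Finite.axiom [:: Fh; F; N; B; T; Th]. Proof. by case. Qed.
HB.instance Definition _ := isFinite.Build V6 V6_enumP.

Definition V6_le (a b : V6) : bool :=
  match a, b with
  | Fh, _ | _, Th => true
  | F, Fh => false
  | F, _ => true
  | N, N | N, T => true
  | B, B | B, T => true
  | T, T => true
  | _, _ => false
  end.

Definition V6_lt (a b : V6) : bool := (b != a) && V6_le a b.

(* The only incomparable pair is {N, B}, whose meet is F and whose join is T. *)
Definition V6_meet (a b : V6) : V6 :=
  if V6_le a b then a else if V6_le b a then b else F.
Definition V6_join (a b : V6) : V6 :=
  if V6_le a b then b else if V6_le b a then a else T.

Fact V6_le_def a b : V6_le a b = (V6_meet a b == a).
Proof. by case: a; case: b. Qed.
Fact V6_meetC : commutative V6_meet. Proof. by do 2!case. Qed.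
Fact V6_joinC : commutative V6_join. Proof. by do 2!case. Qed.
Fact V6_meetA : associative V6_meet. Proof. by do 3!case. Qed.
Fact V6_joinA : associative V6_join. Proof. by do 3!case. Qed.
Fact V6_joinKI b a : V6_meet a (V6_join a b) = a.
Proof. by case: a; case: b. Qed.
Fact V6_meetKU b a : V6_join a (V6_meet a b) = a.
Proof. by case: a; case: b. Qed.
Fact V6_meetUl : left_distributive V6_meet V6_join. Proof. by do 3!case. Qed.
Fact V6_meetxx : idempotent_op V6_meet. Proof. by case. Qed.

Fact V6_display : Order.disp_t. Proof. exact: (Order.Disp tt tt). Qed.

HB.instance Definition _ :=
  Order.isMeetJoinDistrLattice.Build V6_display V6
    V6_le_def (fun _ _ => erefl) V6_meetC V6_joinC V6_meetA V6_joinA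
    V6_joinKI V6_meetKU V6_meetUl V6_meetxx.

Fact V6_le0x a : (Fh <= a)%O. Proof. by case: a. Qed.
Fact V6_lex1 a : (a <= Th)%O. Proof. by case: a. Qed.

HB.instance Definition _ := Order.hasBottom.Build V6_display V6 V6_le0x.
HB.instance Definition _ := Order.hasTop.Build V6_display V6 V6_lex1.

Definition V6_neg (a : V6) : V6 :=
  match a with Fh => Th | F => T | N => N | B => B | T => F | Th => Fh end.

Definition V6_circ (a : V6) : V6 := if a \in [:: Fh; Th] then Th else Fh.

(* The greatest c with a /\ c <= b; V6_impP shows that it always exists, so
   that the default value is never used. *)
Definition V6_imp (a b : V6) : V6 :=
  odflt Fh [pick m : V6 | (Order.meet a m <= b)%O &&
                          [forall c : V6, (Order.meet a c <= b)%O ==> (c <= m)%O]].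

Lemma V6_impP (a b : V6) :
  (Order.meet a (V6_imp a b) <= b)%O /\
  forall c : V6, (Order.meet a c <= b)%O -> (c <= V6_imp a b)%O.
Proof.
rewrite /V6_imp; case: pickP => [m /andP[le_m /forallP max_m]|no_max] /=.
  by split=> // c le_c; move/implyP: (max_m c); apply.
pose m := if (a <= b)%O then Th
          else match a, b with
          | N, _ => if b == Fh then Fh else B
          | B, _ => if b == Fh then Fh else N
          | T, N => N | T, B => B
          | _, _ => b end.
case/negP: (no_max m); rewrite {}/m {no_max}; apply/andP; split.
  by case: a; case: b.
by apply/forallP => c; case: a; case: b; case: c.
Qed.

Record algebra := Algebra {
  carrier :> Type;
  op_and : carrier -> carrier -> carrier;
  op_or : carrier -> carrier -> carrier;
  op_imp : carrier -> carrier -> carrier;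
  op_neg : carrier -> carrier;
  op_circ : carrier -> carrier;
  op_bot : carrier;
  op_top : carrier
}.

Definition PP6H : algebra :=
  @Algebra V6 Order.meet Order.join V6_imp V6_neg V6_circ
    Order.bottom Order.top.

Inductive formula :=
  | Var of nat
  | And of formula & formula
  | Or of formula & formula
  | Imp of formula & formula
  | Neg of formula
  | Circ of formula
  | Bot
  | Top.

Definition formula_algebra : algebra :=
  @Algebra formula And Or Imp Neg Circ Bot Top.

Record hom (A A' : algebra) (h : A -> A') : Prop := Hom {
  hom_and : forall x y, h (op_and x y) = op_and (h x) (h y);
  hom_or : forall x y, h (op_or x y) = op_or (h x) (h y);
  hom_imp : forall x y, h (op_imp x y) = op_imp (h x) (h y);
  hom_neg : forall x, h (op_neg x) = op_neg (h x);
  hom_circ : forall x, h (op_circ x) = op_circ (h x);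
  hom_bot : h (op_bot A) = op_bot A';
  hom_top : h (op_top A) = op_top A'
}.

Record matrix := Matrix {
  matrix_algebra : algebra;
  designated : set matrix_algebra
}.

Definition setset_relation := set formula -> set formula -> Prop.

Definition setset_logic (M : matrix) : setset_relation := fun Phi Psi =>
  forall h : formula -> matrix_algebra M,
    @hom formula_algebra (matrix_algebra M) h ->
    (exists2 phi, Phi phi & ~ designated (h phi)) \/
    (exists2 psi, Psi psi & designated (h psi)).

Definition up (a : V6) : set V6 := [set x : V6 | (a <= x)%O].

Lemma up_B : up B = [set B; T; Th].
Proof.
by apply/seteqP; split=> [[] //= _|x [[]|] -> //]; by [left; left|left; right|right].
Qed.

Fixpoint subst (s : nat -> formula) (a : formula) : formula :=
  match a with
  | Var i => s i
  | And b c => And (subst s b) (subst s c)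
  | Or b c => Or (subst s b) (subst s c)
  | Imp b c => Imp (subst s b) (subst s c)
  | Neg b => Neg (subst s b)
  | Circ b => Circ (subst s b)
  | Bot => Bot
  | Top => Top
  end.

Fixpoint subformulas (a : formula) : set formula :=
  [set a] `|`
  match a with
  | And b c | Or b c | Imp b c => subformulas b `|` subformulas c
  | Neg b | Circ b => subformulas b
  | Var _ | Bot | Top => set0
  end.

Definition subformulas_of (G : set formula) : set formula :=
  \bigcup_(a in G) subformulas a.

Definition Upsilon (Xi G : set formula) : set formula :=
  subformulas_of G `|`
  [set a | exists s, (forall i, subformulas_of G (s i)) /\ (subst s @` Xi) a].

(* (premises, conclusions) *)
Definition rule := (set formula * set formula)%type.
Definition calculus := set rule.

(* A node label; None is the discontinuation label. *)
Definition label := option (set formula).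

Inductive tree := Node of label & seq tree.

Definition root_label (t : tree) : label := let: Node l _ := t in l.

Fixpoint labels (t : tree) : seq label :=
  let: Node l ts := t in l :: flatten (map labels ts).

Fixpoint leaf_labels (t : tree) : seq label :=
  let: Node l ts := t in
  if ts is [::] then [:: l] else flatten (map leaf_labels ts).

Inductive derivation (R : calculus) : tree -> Prop :=
  | derivation_leaf l : derivation R (Node l [::])
  | derivation_expand G Pi Theta s ts :
      R (Pi, Theta) -> subst s @` Pi `<=` G -> Theta !=set0 ->
      [set l | List.In l (map root_label ts)] =
        [set Some (G `|` [set theta]) | theta in subst s @` Theta] ->
      (forall t, List.In t ts -> derivation R t) ->
      derivation R (Node (Some G) ts)
  | derivation_star G Pi s :
      R (Pi, set0) -> subst s @` Pi `<=` G ->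
      derivation R (Node (Some G) [:: Node None [::]]).

Definition derivation_of (R : calculus) (Phi Psi : set formula) (t : tree) :
    Prop :=
  [/\ derivation R t,
      exists2 G, root_label t = Some G & G `<=` Phi &
      forall G, List.In (Some G) (leaf_labels t) -> G `&` Psi !=set0].

Definition derives (R : calculus) : setset_relation := fun Phi Psi =>
  exists t, derivation_of R Phi Psi t.

Definition axiomatizes (R : calculus) (L : setset_relation) : Prop :=
  forall Phi Psi, derives R Phi Psi <-> L Phi Psi.

Definition analytic (Xi : set formula) (R : calculus) : Prop :=
  forall Phi Psi, derives R Phi Psi ->
  exists2 t, derivation_of R Phi Psi t &
    forall G, List.In (Some G) (labels t) ->
      G `<=` Upsilon Xi (Phi `|` Psi).

Declare Scope formula_scope.
Delimit Scope formula_scope with fm.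
Bind Scope formula_scope with formula.
Notation "a ⊓ b" := (And a b) (at level 48, left associativity) : formula_scope.
Notation "a ⊔ b" := (Or a b) (at level 49, left associativity) : formula_scope.
Notation "a ⇒ b" := (Imp a b) (at level 51, right associativity) : formula_scope.
Notation "∼ a" := (Neg a) (at level 35, right associativity) : formula_scope.
Notation "∘ a" := (Circ a) (at level 35, right associativity) : formula_scope.
Notation "⊥" := Bot (at level 0) : formula_scope.
Notation "⊤" := Top (at level 0) : formula_scope.

Section Rules.
Local Open Scope formula_scope.
Let p := Var 0.
Let q := Var 1.

Definition PP6_rules : seq rule := [::
  (set0, [set ⊤]);
  ([set ∼ ⊤], set0);
  (set0, [set ∼ ⊥]);
  ([set ⊥], set0);
  ([set p], [set ∼ ∼ p]);
  ([set ∼ ∼ p], [set p]);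
  ([set p ⊓ q], [set p]);
  ([set p ⊓ q], [set q]);
  ([set p; q], [set p ⊓ q]);
  ([set ∼ p], [set ∼ (p ⊓ q)]);
  ([set ∼ q], [set ∼ (p ⊓ q)]);
  ([set ∼ (p ⊓ q)], [set ∼ p; ∼ q]);
  ([set p], [set p ⊔ q]);
  ([set q], [set p ⊔ q]);
  ([set p ⊔ q], [set p; q]);
  ([set ∼ p; ∼ q], [set ∼ (p ⊔ q)]);
  ([set ∼ (p ⊔ q)], [set ∼ p]);
  ([set ∼ (p ⊔ q)], [set ∼ q]);
  (set0, [set ∘ ⊥]);
  (set0, [set ∘ ⊤]);
  (set0, [set ∘ ∘ p]);
  ([set ∘ p], [set ∘ ∼ p]);
  ([set ∘ ∼ p], [set ∘ p]);
  ([set ∘ p], [set p; ∼ p]);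
  ([set ∘ p; p; ∼ p], set0);
  ([set ∘ p], [set ∘ (p ⊓ q); p]);
  ([set ∘ q], [set ∘ (p ⊓ q); q]);
  ([set ∘ (p ⊓ q); q], [set ∘ p]);
  ([set ∘ (p ⊓ q); p], [set ∘ q]);
  ([set ∘ p; ∘ q], [set ∘ (p ⊓ q)]);
  ([set ∘ (p ⊓ q)], [set ∘ p; ∘ q]);
  ([set ∘ p; ∘ q], [set ∘ (p ⊔ q)]);
  ([set ∘ (p ⊔ q)], [set ∘ p; ∘ q]);
  ([set ∘ p; p], [set ∘ (p ⊔ q)]);
  ([set ∘ q; q], [set ∘ (p ⊔ q)]);
  ([set ∘ (p ⊔ q)], [set ∘ p; q]);
  ([set ∘ (p ⊔ q)], [set ∘ q; p])
].

Definition imp_rules : seq rule := [::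
  ([set q], [set p ⇒ q]);
  ([set p; p ⇒ q], [set q]);
  ([set ∼ (p ⇒ q)], [set ∼ q]);
  ([set ∼ q], [set ∼ (p ⇒ q); ∼ p]);
  (set0, [set p ⇒ q; ∘ q; p]);
  ([set p ⇒ q], [set ∘ (p ⇒ q); ∼ q; q]);
  ([set p ⇒ q; ∘ q], [set ∘ p; q]);
  ([set ∼ (p ⇒ q); ∼ p], [set ∘ (p ⇒ q)]);
  ([set ∼ p], [set ∘ (p ⇒ q); p]);
  ([set ∘ (p ⇒ q); ∘ p; p], [set ∘ q]);
  ([set ∘ (p ⇒ q); p], [set ∘ q; q]);
  ([set ∘ p], [set p ⇒ q; p]);
  ([set ∘ q], [set ∘ (p ⇒ q)]);
  ([set q], [set ∼ (p ⇒ q); ∘ (p ⇒ q); ∘ p])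
].

End Rules.

Definition PP6H_calculus : calculus :=
  [set r | List.In r (PP6_rules ++ imp_rules)].

(* Main.v *)
Require Import Defs.
From mathcomp Require Import all_boot all_order.
From mathcomp Require Import boolp classical_sets.
Local Open Scope classical_set_scope.

Import Order.TTheory.

Set Implicit Arguments.
Unset Strict Implicit.
Unset Printing Implicit Defensive.

(** The matrix is monadic with separators [p], [∼p], [∘p]: a value [a] is
    determined by whether [a], [∼a], [∘a] are designated, and the two missing
    patterns are excluded by the rules [∘p / p, ∼p] and [∘p, p, ∼p / ].
    If [Psi] has no derivation from [Phi] inside [U], the analyticity bound,
    Zorn's lemma gives a maximal [G ⊆ U] above [Phi] from which [Psi] is not
    derivable; being maximal, [G] respects every rule instance whose conclusions
    lie in [U].  Reading off the values of all subformulas from their membership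
    pattern in [G] then yields a homomorphism, because the rules of each
    connective force its truth table.  It refutes [Phi ▷ Psi], so semantic
    consequences have derivations inside [U]: this is both completeness and
    analyticity. *)

(** * Derivability inside a bound, compactness, and maximal extensions *)

Section FinitarySaturation.
Variables (R : calculus) (U Psi : set formula).

(** Derivations without explicit trees. Only the conclusions of a rule are bounded by [U]: premises
    already belong to the current label, which stays inside [U] once the root is. An empty [Theta]
    plays the part of the discontinuation node. *)
Inductive derivable_within : set formula -> Prop :=
  | derivable_within_goal G psi : G psi -> Psi psi -> derivable_within G
  | derivable_within_rule G Pi Theta s :
      R (Pi, Theta) -> subst s @` Pi `<=` G -> subst s @` Theta `<=` U ->
      (forall theta, Theta theta ->
         derivable_within (G `|` [set subst s theta])) ->
      derivable_within G.

Lemma derivable_withinS G G' :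
  G `<=` G' -> derivable_within G -> derivable_within G'.
Proof.
move=> sGG' dG; elim: dG G' sGG' => {G}[G psi Gpsi Ppsi|G Pi Th s RPT sP sT _ IH] G' sGG'.
  by apply: (@derivable_within_goal _ psi) => //; exact: sGG'.
apply: (@derivable_within_rule _ Pi Th s) => // [x /sP /sGG' //|th Tth].
by apply: (IH th Tth) => x [/sGG'|]; [left|right].
Qed.

Definition listed (A : set formula) : Prop :=
  exists l, A = [set x | List.In x l].

Definition finitary : Prop :=
  forall Pi Theta, R (Pi, Theta) -> listed Pi /\ listed Theta.

Hypothesis finR : finitary.

Lemma derivable_within_derivation G :
  derivable_within G -> G `<=` U ->
  exists t, [/\ derivation R t, root_label t = Some G,
    (forall H, List.In (Some H) (leaf_labels t) -> H `&` Psi !=set0) &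
    (forall H, List.In (Some H) (labels t) -> H `<=` U)].
Proof.
elim=> {}G => [psi Gpsi Ppsi sGU|Pi Th s RPT sP sT _ IH sGU].
  exists (Node (Some G) [::]); split=> //=; first exact: derivation_leaf.
    by move=> H [[<-]|//]; exists psi.
  by move=> H [[<-]|].
have [_ [l defT]] := finR RPT; subst Th.
have sGU' th : List.In th l -> G `|` [set subst s th] `<=` U.
  by move=> lth x [/sGU//|->]; apply: sT; exists th.
have {sT} [ts [dts rts lts Lts]] : exists ts, [/\
    (forall t, List.In t ts -> derivation R t),
    map root_label ts = [seq Some (G `|` [set subst s th]) | th <- l],
    (forall H, List.In (Some H) (flatten (map leaf_labels ts)) -> H `&` Psi !=set0) &
    (forall H, List.In (Some H) (flatten (map labels ts)) -> H `<=` U)].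
  elim: l {RPT sT} IH sGU' => [|th l IHl] IH sGU'; first by exists [::].
  have [||ts [dts rts lts Lts]] := IHl.
  - by move=> x lx; apply: IH; right.
  - by move=> x lx; apply: sGU'; right.
  have [||t [dt rt lt Lt]] := IH th; [by left|by apply: sGU'; left|].
  exists (t :: ts); split=> /= [_ [<-|/dts]||H|H] //; first by rewrite rt rts.
    by move/List.in_app_iff => [/lt|/lts].
  by move/List.in_app_iff => [/Lt|/Lts].
(* Without conclusions the only child is the star, which the goal condition on leaves ignores;
   [derivation_expand] covers the nonempty case. *)
case: l => [|th0 l] in RPT {IH sGU'} rts *.
  exists (Node (Some G) [:: Node None [::]]); split=> //=; last first.
  - by move=> H [[<-]|[]].
  - by move=> H [].
  exact: (@derivation_star _ _ Pi s).
exists (Node (Some G) ts); split=> //=.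
- apply: (@derivation_expand _ _ Pi _ s) RPT sP _ _ dts; first by exists th0; left.
  rewrite rts; apply/seteqP; split=> x /=.
    move/(List.in_map_iff (fun y => Some (G `|` [set subst s y])) (th0 :: l)).
    case=> th [<- lth].
    by exists (subst s th) => //; exists th.
  case=> _ [th lth <-] <-.
  exact: (@List.in_map _ _ (fun y => Some (G `|` [set subst s y])) (th0 :: l)).
- by case: ts rts lts {dts Lts}.
- by move=> H [[<-]|/Lts].
Qed.

(** Of two members of a chain, one contains the other, so finitely many monotone properties can be
    gathered in one member. *)
Lemma chain_seq (I : Type) (F : set (set formula)) (Q : I -> set formula -> Prop)
    (l : seq I) :
  F !=set0 -> total_on F subset ->
  (forall i X Y, X `<=` Y -> Q i X -> Q i Y) ->
  (forall i, List.In i l -> exists2 X, F X & Q i X) ->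
  exists2 X, F X & forall i, List.In i l -> Q i X.
Proof.
move=> [X0 FX0] totF Qmono; elim: l => [|i l IHl] ex; first by exists X0.
have [|X FX QX] := IHl; first by move=> j lj; apply: ex; right.
have [|Y FY QY] := ex i; first by left.
have [sXY|sYX] := totF _ _ FX FY.
- by exists Y => // j [<-//|/QX]; apply: Qmono.
- by exists X => // j [<-|/QX//]; apply: Qmono QY.
Qed.

(** Compactness: premises and branches are finite in number, so one member of the chain serves them
    all. The parameter [K] absorbs the conclusions added along a branch, which need not come from
    the chain. *)
Lemma derivable_within_chain G (F : set (set formula)) K :
  F !=set0 -> total_on F subset ->
  derivable_within G -> G `<=` K `|` \bigcup_(X in F) X ->
  exists2 X, F X & derivable_within (K `|` X).
Proof.
move=> F0 totF dG; elim: dG K => {G}[G psi Gpsi Ppsi|G Pi Th s RPT sP sT _ IH] K sG.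
  have [Kpsi|[X FX Xpsi]] := sG _ Gpsi.
    have [X FX] := F0; exists X => //.
    by apply: (@derivable_within_goal _ psi) => //; left.
  by exists X => //; apply: (@derivable_within_goal _ psi) => //; right.
have [[lP defP] [lT defT]] := finR RPT; subst Pi Th.
have [||X FX XP] := @chain_seq _ F (fun x X => (K `|` X) (subst s x)) lP F0 totF.
- by move=> x X Y sXY [|/sXY]; [left|right].
- move=> x lx; have [|Kx|[X FX Xx]] := sG (subst s x).
  + by apply: sP; exists x.
  + by have [X FX] := F0; exists X => //; left.
  + by exists X => //; right.
have [||Y FY YT] := @chain_seq _ F
    (fun x X => derivable_within ((K `|` [set subst s x]) `|` X)) lT F0 totF.
- by move=> x A B' sAB; apply: derivable_withinS; apply: setUS.
- move=> x lx; apply: (IH x lx) => y [/sG[Ky|Fy]|->]; [by left; left|by right|].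
  by left; right.
have [Z FZ [sXZ sYZ]] : exists2 Z, F Z & X `<=` Z /\ Y `<=` Z.
  by have [sXY|sYX] := totF _ _ FX FY; [exists Y|exists X] => //; split.
exists Z => //; apply: (@derivable_within_rule _ _ _ s RPT) => //.
  by move=> _ [x /XP[|/sXZ] ? <-]; [left|right].
move=> th /YT; apply: derivable_withinS => y [[]|/sYZ] ?; [|by right|].
  by left; left.
by left; right.
Qed.

(** If no conclusion of an applicable rule lay in the maximal set, adjoining any one of them would
    make [Psi] derivable, and the rule would join these derivations into one from the maximal set
    itself. *)
Lemma saturated_extension Phi :
  Phi `<=` U -> ~ derivable_within Phi ->
  exists G, [/\ Phi `<=` G, G `&` Psi = set0 &
    forall Pi Theta s, R (Pi, Theta) -> subst s @` Pi `<=` G ->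
      subst s @` Theta `<=` U -> subst s @` Theta `&` G !=set0].
Proof.
move=> sPU ndP.
(* Keeping [Phi] outside [X] makes the empty union admissible, which the empty chain requires. *)
have [F FP totF|A [[sAU ndA] maxA]] := @Zorn_bigcup _
    (fun X : set formula => X `<=` U /\ ~ derivable_within (Phi `|` X)).
  split=> [x [X /FP[sXU _] /sXU //]|dF].
  have [F0|/set0P/negP] := pselect (F !=set0); last first.
    rewrite negbK => /eqP F0; move: dF; rewrite F0 bigcup_set0 setU0.
    exact: ndP.
  have [X /FP[_ +] dX] := @derivable_within_chain _ F Phi F0 totF dF (@subset_refl _ _).
  exact.
exists (Phi `|` A); split=> [x|| Pi Th s RPT sP sT]; first by left.
  apply/seteqP; split=> // x [Gx Px]; apply: ndA.
  exact: (@derivable_within_goal _ x).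
apply: contrapT => noT; apply: ndA.
apply: (@derivable_within_rule _ Pi Th s) => // th Tth.
apply: contrapT => nd.
have Gth : ~ (Phi `|` A) (subst s th).
  by move=> Gth; apply: noT; exists (subst s th); split=> //; exists th.
apply: (maxA (A `|` [set subst s th])).
  split=> [x|sub]; first by left.
  by apply: Gth; right; apply: sub; right.
split; last by rewrite setUA.
by move=> x [/sAU//|->]; apply: sT; exists th.
Qed.

End FinitarySaturation.

(** * Rules as pairs of lists, grouped by connective *)

Definition seq_set (l : seq formula) : set formula :=
  if l is a :: l' then foldl (fun A x => A `|` [set x]) [set a] l' else set0.

Definition seq_rule := (seq formula * seq formula)%type.

Definition rule_of (r : seq_rule) : rule := (seq_set r.1, seq_set r.2).

Lemma seq_setE l : seq_set l = [set x | List.In x l].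
Proof.
case: l => [|a l] /=; first by apply/seteqP; split.
have foldE A : foldl (fun A x => A `|` [set x]) A l = A `|` [set x | List.In x l].
  elim: l A => [|b l IHl] A /=.
    by apply/seteqP; split=> x; [left|case].
  rewrite IHl; apply/seteqP; split=> x /=.
    by case=> [[]|]; [left|right; left|right; right].
  by case=> [|[]]; [left; left|left; right|right].
by rewrite foldE; apply/seteqP; split=> x [] h; [left|right|left|right].
Qed.

Section SeqRules.
Local Open Scope formula_scope.
Let p := Var 0.
Let q := Var 1.

Definition const_rules : seq seq_rule := [::
  ([::], [:: ⊤]); ([:: ∼ ⊤], [::]); ([::], [:: ∼ ⊥]); ([:: ⊥], [::])].

Definition neg_rules : seq seq_rule := [::
  ([:: p], [:: ∼ ∼ p]); ([:: ∼ ∼ p], [:: p])].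

Definition and_rules : seq seq_rule := [::
  ([:: p ⊓ q], [:: p]);
  ([:: p ⊓ q], [:: q]);
  ([:: p; q], [:: p ⊓ q]);
  ([:: ∼ p], [:: ∼ (p ⊓ q)]);
  ([:: ∼ q], [:: ∼ (p ⊓ q)]);
  ([:: ∼ (p ⊓ q)], [:: ∼ p; ∼ q])].

Definition or_rules : seq seq_rule := [::
  ([:: p], [:: p ⊔ q]);
  ([:: q], [:: p ⊔ q]);
  ([:: p ⊔ q], [:: p; q]);
  ([:: ∼ p; ∼ q], [:: ∼ (p ⊔ q)]);
  ([:: ∼ (p ⊔ q)], [:: ∼ p]);
  ([:: ∼ (p ⊔ q)], [:: ∼ q])].

Definition circ_const_rules : seq seq_rule := [::
  ([::], [:: ∘ ⊥]); ([::], [:: ∘ ⊤])].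

Definition circ_circ_rules : seq seq_rule := [:: ([::], [:: ∘ ∘ p])].

Definition circ_neg_rules : seq seq_rule := [::
  ([:: ∘ p], [:: ∘ ∼ p]); ([:: ∘ ∼ p], [:: ∘ p])].

Definition circ_rules : seq seq_rule := [::
  ([:: ∘ p], [:: p; ∼ p]); ([:: ∘ p; p; ∼ p], [::])].

Definition circ_and_rules : seq seq_rule := [::
  ([:: ∘ p], [:: ∘ (p ⊓ q); p]);
  ([:: ∘ q], [:: ∘ (p ⊓ q); q]);
  ([:: ∘ (p ⊓ q); q], [:: ∘ p]);
  ([:: ∘ (p ⊓ q); p], [:: ∘ q]);
  ([:: ∘ p; ∘ q], [:: ∘ (p ⊓ q)]);
  ([:: ∘ (p ⊓ q)], [:: ∘ p; ∘ q])].

Definition circ_or_rules : seq seq_rule := [::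
  ([:: ∘ p; ∘ q], [:: ∘ (p ⊔ q)]);
  ([:: ∘ (p ⊔ q)], [:: ∘ p; ∘ q]);
  ([:: ∘ p; p], [:: ∘ (p ⊔ q)]);
  ([:: ∘ q; q], [:: ∘ (p ⊔ q)]);
  ([:: ∘ (p ⊔ q)], [:: ∘ p; q]);
  ([:: ∘ (p ⊔ q)], [:: ∘ q; p])].

Definition heyting_rules : seq seq_rule := [::
  ([:: q], [:: p ⇒ q]);
  ([:: p; p ⇒ q], [:: q]);
  ([:: ∼ (p ⇒ q)], [:: ∼ q]);
  ([:: ∼ q], [:: ∼ (p ⇒ q); ∼ p]);
  ([::], [:: p ⇒ q; ∘ q; p]);
  ([:: p ⇒ q], [:: ∘ (p ⇒ q); ∼ q; q]);
  ([:: p ⇒ q; ∘ q], [:: ∘ p; q]);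
  ([:: ∼ (p ⇒ q); ∼ p], [:: ∘ (p ⇒ q)]);
  ([:: ∼ p], [:: ∘ (p ⇒ q); p]);
  ([:: ∘ (p ⇒ q); ∘ p; p], [:: ∘ q]);
  ([:: ∘ (p ⇒ q); p], [:: ∘ q; q]);
  ([:: ∘ p], [:: p ⇒ q; p]);
  ([:: ∘ q], [:: ∘ (p ⇒ q)]);
  ([:: q], [:: ∼ (p ⇒ q); ∘ (p ⇒ q); ∘ p])].

Definition seq_rules : seq seq_rule :=
  const_rules ++ neg_rules ++ and_rules ++ or_rules ++ circ_const_rules ++
  circ_circ_rules ++ circ_neg_rules ++ circ_rules ++ circ_and_rules ++
  circ_or_rules ++ heyting_rules.

End SeqRules.

Lemma PP6H_calculusP Pi Theta :
  PP6H_calculus (Pi, Theta) <->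
  exists2 r, List.In r seq_rules & rule_of r = (Pi, Theta).
Proof.
(* True by conversion: [seq_set] nests unions to the left exactly as [[set a; b; c]] does, and
   [seq_rules] keeps the order of the rules. *)
have rulesE : PP6_rules ++ imp_rules = map rule_of seq_rules by [].
rewrite -[PP6H_calculus _]/(List.In (Pi, Theta) (PP6_rules ++ imp_rules)).
rewrite rulesE; apply: (iff_trans (List.in_map_iff rule_of seq_rules _)).
by split=> [[r []]|[r]]; exists r.
Qed.

Lemma PP6H_finitary : finitary PP6H_calculus.
Proof.
by move=> Pi Th /PP6H_calculusP[r _ [<- <-]]; split; eexists; apply: seq_setE.
Qed.

(** * Soundness of the rules and of derivations *)

Definition rule_ok (m : formula -> bool) (r : seq_rule) : bool :=
  all m r.1 ==> has m r.2.

Lemma all_In (T : Type) (a : pred T) s :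
  all a s <-> forall x, List.In x s -> a x.
Proof.
elim: s => [|y s IHs] //=; split=> [/andP[ay /IHs as_] x [<-//|/as_//]|as_].
by rewrite as_ /=; [apply/IHs => x sx; apply: as_; right|left].
Qed.

Lemma has_In (T : Type) (a : pred T) s :
  has a s <-> exists2 x, List.In x s & a x.
Proof.
elim: s => [|y s IHs] /=; first by split=> // -[].
split=> [/orP[ay|/IHs[x sx ax]]|[x [<- ->//|sx ax]]].
- by exists y; [left|].
- by exists x; [right|].
- by apply/orP; right; apply/IHs; exists x.
Qed.

Fixpoint eval (e : nat -> V6) (a : formula) : V6 :=
  match a with
  | Var i => e i
  | And b c => V6_meet (eval e b) (eval e c)
  | Or b c => V6_join (eval e b) (eval e c)
  | Imp b c => V6_imp (eval e b) (eval e c)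
  | Neg b => V6_neg (eval e b)
  | Circ b => V6_circ (eval e b)
  | Bot => Fh
  | Top => Th
  end.

Lemma eval_hom e : @hom formula_algebra PP6H (eval e).
Proof. by split. Qed.

Lemma hom_subst (h : formula -> V6) s a :
  @hom formula_algebra PP6H h -> h (subst s a) = eval (h \o s) a.
Proof.
case=> hA hO hI hN hC hB hT.
elim: a => //= [b <- c <-|b <- c <-|b <- c <-|b <-|b <-].
- exact: hA.
- exact: hO.
- exact: hI.
- exact: hN.
- exact: hC.
Qed.

(** The choice by [pick] in [V6_imp] is unsuited to checks by cases; this closed form makes them
    computations. It follows by antisymmetry from the two halves of [V6_impP]. *)
Lemma V6_impE a b : V6_imp a b =
  if V6_le a b then Th else
  match a, b with
  | _, Fh => Fh
  | N, _ => B
  | B, _ => N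
  | _, _ => b
  end.
Proof.
have [le_imp max_imp] := V6_impP a b.
apply: (@le_anti _ V6); apply/andP; split.
  by move: le_imp {max_imp}; case: (V6_imp a b); case: a; case: b.
by apply: max_imp; clear; case: a; case: b.
Qed.

Lemma seq_rules_sound e : all (rule_ok (fun a => V6_le B (eval e a))) seq_rules.
Proof.
by rewrite /rule_ok /= !V6_impE; case: (e 0); case: (e 1).
Qed.

(** A valuation that designates the root label can be followed down a branch: each rule applied has
    a designated conclusion, which selects the next child. Rules without conclusions are never met,
    since their premises cannot all be designated. *)
Lemma derivation_sound (h : formula -> V6) t :
  @hom formula_algebra PP6H h -> derivation PP6H_calculus t ->
  forall G, root_label t = Some G -> G `<=` h @^-1` up B ->
  exists2 H, List.In (Some H) (leaf_labels t) & H `<=` h @^-1` up B.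
Proof.
move=> hh; have ok Pi Th s G : PP6H_calculus (Pi, Th) ->
    subst s @` Pi `<=` G -> G `<=` h @^-1` up B ->
    exists2 th, Th th & up B (h (subst s th)).
  case/PP6H_calculusP => r lr [<- <-] sP sG.
  have /has_In[x rx Bx] : has (fun a => V6_le B (eval (h \o s) a)) r.2.
    move/all_In: (seq_rules_sound (h \o s)) => /(_ r lr) /implyP; apply.
    apply/all_In => x rx; rewrite -hom_subst //.
    by apply: (sG (subst s x)); apply: sP; exists x; rewrite ?seq_setE.
  exists x; first by rewrite seq_setE.
  by rewrite hom_subst.
elim=> {t}[l G /= -> sG|G Pi Th s ts RPT sP _ rts _ IH _ [<-] sG|G Pi s RPT sP _ [<-] sG].
- by exists G => //; left.
- have [th Tth Bth] := ok _ _ _ _ RPT sP sG.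
  have : [set l | List.In l (map root_label ts)] (Some (G `|` [set subst s th])).
    by rewrite rts; exists (subst s th) => //; exists th.
  move=> /= /List.in_map_iff[t [rt lt]].
  have [|H lH sH] := IH _ lt _ rt; first by move=> x [/sG|->].
  (* The node has a child, so its leaves are those of its subtrees. *)
  exists H => //; case: ts lt {rts IH} => // t0 ts lt.
  move: (t0 :: ts) lt => {t0} {}ts; elim: ts => //= t1 ts IHts [->|/IHts lH'];
    apply/List.in_app_iff; [by left|by right].
- by have [] := ok _ _ _ _ RPT sP sG.
Qed.

(* The value whose designation pattern on [p], [∼p], [∘p] is the given triple;
   the patterns (0,0,1) and (1,1,1) do not occur. *)
Definition value_of (x nx cx : bool) : V6 :=
  match x, nx, cx with
  | false, false, _ => N
  | false, true, false => F
  | false, true, true => Fh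
  | true, true, _ => B
  | true, false, false => T
  | true, false, true => Th
  end.

Definition value (m : formula -> bool) (a : formula) : V6 :=
  value_of (m a) (m (Neg a)) (m (Circ a)).

(** Exactly what [circ_rules] impose at [a]: the two patterns without a value are excluded. *)
Definition proper (m : formula -> bool) (a : formula) : bool :=
  m (Circ a) ==> (m a (+) m (Neg a)).

Lemma value_up m a : proper m a -> V6_le B (value m a) = m a.
Proof. by rewrite /proper /value; do 3!case: (m _). Qed.

(** * Truth tables forced by the rules of each connective *)

Section TruthTables.
Variable m : formula -> bool.
Let p := Var 0.
Let q := Var 1.

Lemma value_top : all (rule_ok m)
    [:: ([::], [:: Top]); ([:: Neg Top], [::]); ([::], [:: Circ Top])] ->
  value m Top = Th.
Proof. by rewrite /value /rule_ok /=; do 3!case: (m _). Qed.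

Lemma value_bot : all (rule_ok m)
    [:: ([::], [:: Neg Bot]); ([:: Bot], [::]); ([::], [:: Circ Bot])] ->
  value m Bot = Fh.
Proof. by rewrite /value /rule_ok /=; do 3!case: (m _). Qed.

(** Stated at variables, as are the binary cases below: replacing [m] by [m \o subst s] gives the
    table at arbitrary formulas and turns [rule_ok] into a condition on rule instances. *)
Lemma value_neg : proper m p -> proper m (Neg p) ->
  all (rule_ok m) (neg_rules ++ circ_neg_rules) ->
  value m (Neg p) = V6_neg (value m p).
Proof.
rewrite /proper /value /rule_ok /=.
by case: (m p); case: (m (Neg p)); case: (m (Circ p));
   case: (m (Neg (Neg p))); case: (m (Circ (Neg p))).
Qed.

Lemma value_circ : proper m p -> proper m (Circ p) ->
  all (rule_ok m) circ_circ_rules ->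
  value m (Circ p) = V6_circ (value m p).
Proof.
rewrite /proper /value /rule_ok /=.
by case: (m p); case: (m (Neg p)); case: (m (Circ p));
   case: (m (Neg (Circ p))); case: (m (Circ (Circ p))).
Qed.

Lemma value_and : proper m p -> proper m q -> proper m (And p q) ->
  all (rule_ok m) (and_rules ++ circ_and_rules) ->
  value m (And p q) = V6_meet (value m p) (value m q).
Proof.
rewrite /proper /value /rule_ok /=.
by case: (m p); case: (m (Neg p)); case: (m (Circ p));
   case: (m q); case: (m (Neg q)); case: (m (Circ q));
   case: (m (And p q)); case: (m (Neg (And p q))); case: (m (Circ (And p q))).
Qed.

Lemma value_or : proper m p -> proper m q -> proper m (Or p q) ->
  all (rule_ok m) (or_rules ++ circ_or_rules) ->
  value m (Or p q) = V6_join (value m p) (value m q).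
Proof.
rewrite /proper /value /rule_ok /=.
by case: (m p); case: (m (Neg p)); case: (m (Circ p));
   case: (m q); case: (m (Neg q)); case: (m (Circ q));
   case: (m (Or p q)); case: (m (Neg (Or p q))); case: (m (Circ (Or p q))).
Qed.

Lemma value_imp : proper m p -> proper m q -> proper m (Imp p q) ->
  all (rule_ok m) heyting_rules ->
  value m (Imp p q) = V6_imp (value m p) (value m q).
Proof.
rewrite V6_impE /proper /value /rule_ok /=.
by case: (m p); case: (m (Neg p)); case: (m (Circ p));
   case: (m q); case: (m (Neg q)); case: (m (Circ q));
   case: (m (Imp p q)); case: (m (Neg (Imp p q))); case: (m (Circ (Imp p q))).
Qed.

End TruthTables.

(** * Subformulas and the analyticity bound *)

Lemma subformulas_refl a : subformulas a a.
Proof. by case: a => *; left. Qed.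

Lemma subformulas_trans a b c :
  subformulas a b -> subformulas b c -> subformulas a c.
Proof.
move=> ab bc; elim: a ab => [i|a IHa a' IHa'|a IHa a' IHa'|a IHa a' IHa'|a IHa|a IHa||] /=;
  case=> [eqb|]; try by rewrite eqb in bc.
1,7,8: by [].
1-3: by case=> [/IHa|/IHa'] ac; right; [left|right].
all: by move/IHa; right.
Qed.

Lemma subformulas_ofS G a b :
  subformulas a b -> subformulas_of G a -> subformulas_of G b.
Proof. by move=> ab [c Gc ca]; exists c => //; apply: subformulas_trans ab. Qed.

Lemma sub_subformulas_of G : G `<=` subformulas_of G.
Proof. by move=> a Ga; exists a => //; apply: subformulas_refl. Qed.

Local Notation Xi := [set Var 0; Neg (Var 0); Circ (Var 0)].

Lemma Upsilon_separators G a : subformulas_of G a ->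
  [/\ Upsilon Xi G a, Upsilon Xi G (Neg a) & Upsilon Xi G (Circ a)].
Proof.
(* A constant substitution, because every variable must be sent to a subformula. *)
move=> Sa; split; right; exists (fun=> a); split=> //.
- by exists (Var 0) => //; left; left.
- by exists (Neg (Var 0)) => //; left; right.
- by exists (Circ (Var 0)) => //; right.
Qed.

(** Discharges both side conditions of [ok] below: the group is part of [seq_rules], and every
    conclusion is [x], [∼x] or [∘x] for some [x] among the three given subformulas, hence lies in
    the bound. *)
Ltac check_rules Sa Sb Sc :=
  let r := fresh "r" in let rl := fresh "rl" in
  move=> r rl; first [by simpl in *; tauto |
  have [? ? ?] := Upsilon_separators Sa;
  have [? ? ?] := Upsilon_separators Sb;
  have [? ? ?] := Upsilon_separators Sc;
  repeat (case: rl => [<-|rl]; [by move=> c /=; intuition (subst; assumption)|]);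
  by case: rl].

(** * Countermodel from a saturated set *)

Lemma semantic_derivable_within Phi Psi :
  setset_logic (@Matrix PP6H (up B)) Phi Psi ->
  derivable_within PP6H_calculus (Upsilon Xi (Phi `|` Psi)) Psi Phi.
Proof.
move=> PP; apply: contrapT => nd; set U := Upsilon Xi _ in nd.
set S := subformulas_of (Phi `|` Psi).
have [|G [sPG GP sat]] := saturated_extension PP6H_finitary _ nd.
  by move=> x Px; left; apply: sub_subformulas_of; left.
pose m a := `[< G a >].
have ok l s : (forall r, List.In r l -> List.In r seq_rules) ->
    (forall r, List.In r l -> forall c, List.In c r.2 -> U (subst s c)) ->
    all (rule_ok (m \o subst s)) l.
  move=> lR lU; apply/all_In => r lr; apply/implyP => /all_In r1.
  have [|||c [[x rx <-] Gx]] := sat (seq_set r.1) (seq_set r.2) s.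
  - by apply/PP6H_calculusP; exists r => //; apply: lR.
  - by move=> _ [x rx <-]; rewrite seq_setE in rx; apply/asboolP; apply: r1.
  - by move=> _ [x rx <-]; rewrite seq_setE in rx; apply: lU rx.
  by apply/has_In; exists x; [rewrite seq_setE in rx|apply/asboolP].
pose s2 a b i := if i is 0 then a else b : formula.
have prop a : S a -> proper m a.
  move=> Sa; have : all (rule_ok (m \o subst (s2 a a))) circ_rules.
    by apply: ok; check_rules Sa Sa Sa.
  rewrite /rule_ok /proper /=.
  by case: (m a); case: (m (Neg a)); case: (m (Circ a)).
have Sbin c a b : [\/ c = And a b, c = Or a b | c = Imp a b] -> S c -> S a /\ S b.
  by case=> -> Sc; split; apply: subformulas_ofS Sc; right;
     [left|right|left|right|left|right]; apply: subformulas_refl.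
(* Saturation controls [m] only inside [U], so [h] is generated from the variables and compared with
   [value m] on [S] alone. *)
pose h := eval (fun i => value m (Var i)).
have Ok a : S a -> h a = value m a.
  elim: a => [i|a IHa b IHb|a IHa b IHb|a IHa b IHb|a IHa|a IHa||] // Sc.
  - have [Sa Sb] := Sbin _ _ _ (Or31 _ _ erefl) Sc.
    rewrite -[LHS]/(V6_meet (h a) (h b)) IHa // IHb //; apply/esym.
    by apply: (@value_and (m \o subst (s2 a b))); rewrite ?[proper _ _]prop //;
       apply: ok; check_rules Sa Sb Sc.
  - have [Sa Sb] := Sbin _ _ _ (Or32 _ _ erefl) Sc.
    rewrite -[LHS]/(V6_join (h a) (h b)) IHa // IHb //; apply/esym.
    by apply: (@value_or (m \o subst (s2 a b))); rewrite ?[proper _ _]prop //;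
       apply: ok; check_rules Sa Sb Sc.
  - have [Sa Sb] := Sbin _ _ _ (Or33 _ _ erefl) Sc.
    rewrite -[LHS]/(V6_imp (h a) (h b)) IHa // IHb //; apply/esym.
    by apply: (@value_imp (m \o subst (s2 a b))); rewrite ?[proper _ _]prop //;
       apply: ok; check_rules Sa Sb Sc.
  - have Sa : S a by apply: subformulas_ofS Sc; right; apply: subformulas_refl.
    rewrite -[LHS]/(V6_neg (h a)) IHa //; apply/esym.
    by apply: (@value_neg (m \o subst (s2 a a))); rewrite ?[proper _ _]prop //;
       apply: ok; check_rules Sa Sa Sc.
  - have Sa : S a by apply: subformulas_ofS Sc; right; apply: subformulas_refl.
    rewrite -[LHS]/(V6_circ (h a)) IHa //; apply/esym.
    by apply: (@value_circ (m \o subst (s2 a a))); rewrite ?[proper _ _]prop //;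
       apply: ok; check_rules Sa Sa Sc.
  (* The rules for constants contain no variables, so the identity substitution does. *)
  - by apply/esym/(@value_bot (m \o subst Var)); apply: ok; check_rules Sc Sc Sc.
  - by apply/esym/(@value_top (m \o subst Var)); apply: ok; check_rules Sc Sc Sc.
(* Neither alternative survives: [h] designates all of [Phi], which lies in [G], and a designated
   member of [Psi] would lie in [G] too. *)
have [[a Pa]|[a Pa]] := PP h (eval_hom _).
  have Sa : S a by apply: sub_subformulas_of; left.
  by apply; rewrite /= Ok // /up /= [(_ <= _)%O]value_up ?prop //; apply/asboolP/sPG.
have Sa : S a by apply: sub_subformulas_of; right.
rewrite /= Ok // /up /= [(_ <= _)%O]value_up ?prop // => /asboolP Ga.
by have : (G `&` Psi) a by []; rewrite GP.
Qed.

Theorem theorem5p3 :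
  axiomatizes PP6H_calculus (setset_logic (@Matrix PP6H (up B))) /\
  analytic [set Var 0; Neg (Var 0); Circ (Var 0)] PP6H_calculus.
Proof.
have sound Phi Psi : derives PP6H_calculus Phi Psi ->
    setset_logic (@Matrix PP6H (up B)) Phi Psi.
  case=> t [dt [G rt sGP] leaves] h hh.
  have [sPD|/existsNP[a /not_implyP[Pa nDa]]] := pselect (Phi `<=` h @^-1` up B);
    last by left; exists a.
  right; have [|H /leaves[a [Ha Pa]] sH] := derivation_sound hh dt rt.
    exact: subset_trans sPD.
  by exists a => //; apply: sH.
have complete Phi Psi : setset_logic (@Matrix PP6H (up B)) Phi Psi ->
    exists2 t, derivation_of PP6H_calculus Phi Psi t &
    forall G, List.In (Some G) (labels t) -> G `<=` Upsilon Xi (Phi `|` Psi).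
  move=> /semantic_derivable_within /(derivable_within_derivation PP6H_finitary).
  case=> [x Px|t [dt rt leaves labs]]; first by left; apply: sub_subformulas_of; left.
  by exists t => //; split=> //; exists Phi.
(* Analyticity passes through the semantics: soundness turns any derivation into a consequence, and
   completeness returns a derivation inside the bound. *)
split=> [Phi Psi|Phi Psi /sound /complete //]; split=> [/sound //|/complete[t dt _]].
by exists t.
Qed.
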